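(* Assume the Hypothesis stated in the context. Then the closure $\mathcal L$ of $\mathcal L_0$ is given by $$\mathcal L=\begin{pmatrix} I & -CA^{-1}\\ 0 & I\end{pmatrix}\begin{pmatrix} 0 & \mathrm i\,\overline{T(0)}\\ -\mathrm i A & 0\end{pmatrix}\begin{pmatrix} I & \overline{A^{-1}C^*}\\ 0 & I\end{pmatrix}$$ and $\mathrm{dom}(\mathcal L)=\mathrm{dom}(\mathcal A)$. Moreover, $$\sigma(\mathcal L)=\{z\in\mathbb C:\ 0\in\sigma(\overline{T(z)})\},\qquad \sigma_i(\mathcal L)=\{z\in\mathbb C:\ 0\in\sigma_i(\overline{T(z)})\},\quad i\in\{\mathrm p,\mathrm c,\mathrm{ess}\}.$$
   Context: Let $\mathcal H$ be a complex separable Hilbert space, $\mathfrak H=\mathcal H\times\mathcal H$, and let $A,B,C$ be (possibly unbounded) linear operators in $\mathcal H$. For a self-adjoint operator $R$, $\kappa_-(R)=\dim\operatorname{ran}\chi_{(-\infty,0)}(R)$ (spectral projection). Hypothesis: (i) $A$ is self-adjoint with $0\in\rho(A)$ and $\kappa_-(A)<\infty$; (ii) $C$ is closed, $\mathrm{dom}(A)\subset\mathrm{dom}(C)$ and $\mathrm{dom}(A)\subset\mathrm{dom}(C^* )$; (iii) $B=B^*$; (iv) $\mathrm{dom}(S_0):=\mathrm{dom}(C^* )\cap\mathrm{dom}(B)$ is dense in $\mathcal H$, and $S_0:=B-CA^{-1}C^*$ is essentially self-adjoint on $\mathrm{dom}(S_0)$ with $\kappa_-(\overline{S_0})<\infty$.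 Put $\mathcal J=\begin{pmatrix}0&\mathrm i I\\-\mathrm i I&0\end{pmatrix}$. The operator $\mathcal A_0=\begin{pmatrix}A&C^*\\C&B\end{pmatrix}$ with $\mathrm{dom}(\mathcal A_0)=\mathrm{dom}(A)\times\mathrm{dom}(S_0)$ is (under the Hypothesis, as is known) essentially self-adjoint in $\mathfrak H$; $\mathcal L_0=\mathcal J\mathcal A_0=\begin{pmatrix}\mathrm iC&\mathrm iB\\-\mathrm iA&-\mathrm iC^*\end{pmatrix}$ on the same domain. $\mathcal A$ and $\mathcal L$ denote the closures of $\mathcal A_0$ and $\mathcal L_0$. For $z\in\mathbb C$ set $T(z)=B-(C+\mathrm i z)A^{-1}(C^*-\mathrm i z)$ with $\mathrm{dom}(T(z))=\mathrm{dom}(C^* )\cap\mathrm{dom}(B)$. An overline on an operator denotes its closure. $\sigma_{\mathrm p},\sigma_{\mathrm c},\sigma_{\mathrm{ess}}$ denote the point spectrum, the continuous spectrum (operator minus $\lambda$ injective with dense, proper range) and the essential spectrum (operator minus $\lambda$ not Fredholm). *)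

(* Defs.v *)
From HB Require Import structures.
From mathcomp Require Import all_boot all_order all_algebra.
From mathcomp Require Import all_classical all_reals all_analysis.
From mathcomp Require Import complex.

Set Implicit Arguments.
Unset Strict Implicit.
Unset Printing Implicit Defensive.

Import Order.TTheory GRing.Theory Num.Theory.
Import numFieldNormedType.Exports.

Local Open Scope classical_set_scope.
Local Open Scope ring_scope.

(* A possibly unbounded operator from U to V is represented by its graph, a
   subset of U * V.  Equality of operators is equality of graphs (same domain
   and same values), the closure of an operator is the topological [closure]
   of its graph, and an operator is closed when its graph is. *)

Declare Scope op_scope.
Delimit Scope op_scope with Op.

Section Operators.
Context {K : numFieldType}.
Implicit Types U V W : normedModType K.

Definition is_linear_op U V (T : set (U * V)) : Prop :=
  [/\ T 0,
      (forall (a : K) p q, T p -> T q -> T (a *: p + q)) &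
      (forall x y y', T (x, y) -> T (x, y') -> y = y')].

Definition dom U V (T : set (U * V)) : set U := [set x | exists y, T (x, y)].

Definition ran U V (T : set (U * V)) : set V := [set y | exists x, T (x, y)].

Definition ker U V (T : set (U * V)) : set U := [set x | T (x, 0)].

Definition closable U V (T : set (U * V)) : Prop := is_linear_op (closure T).

Definition op_scal {V} (a : K) : set (V * V) := [set p | p.2 = a *: p.1].

Definition op_opp U V (T : set (U * V)) : set (U * V) :=
  [set p | T (p.1, - p.2)].

(* Sums and products have their natural domains: dom S `&` dom T for the sum,
   and the x in dom T with T x in dom S for the product. *)
Definition op_add U V (S T : set (U * V)) : set (U * V) :=
  [set p | exists u v, [/\ S (p.1, u), T (p.1, v) & p.2 = u + v]].

Definition op_mul U V W (S : set (V * W)) (T : set (U * V)) : set (U * W) :=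
  [set p | exists2 v, T (p.1, v) & S (v, p.2)].

Definition op_inv U V (T : set (U * V)) : set (V * U) :=
  [set p | T (p.2, p.1)].

(* V * V carries the library's sup norm, which is equivalent to the Hilbert
   norm; closures, boundedness, spectra and Fredholmness do not distinguish
   the two.

   The 2 x 2 operator matrix with rows (A, B) and (C, D); its domain is
   (dom A `&` dom C) `*` (dom B `&` dom D). *)
Definition op_block V (A B C D : set (V * V)) : set ((V * V) * (V * V)) :=
  [set p | exists a b c d,
    [/\ A (p.1.1, a), B (p.1.2, b), C (p.1.1, c), D (p.1.2, d) &
        p.2 = (a + b, c + d)]].

End Operators.

Notation "a %:I" := (op_scal a) (at level 2, format "a %:I") : op_scope.
Notation "- T" := (op_opp T) : op_scope.
Notation "S + T" := (op_add S T) : op_scope.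
Notation "S - T" := (op_add S (op_opp T)) : op_scope.
Notation "S * T" := (op_mul S T) : op_scope.
Notation "T ^-1" := (op_inv T) : op_scope.

Section Spectrum.
Context {K : numFieldType}.
Implicit Types V : normedModType K.

Definition finite_dim V (S : set V) : Prop :=
  exists (n : nat) (v : 'I_n -> V),
    forall x, S x -> exists c : 'I_n -> K, x = \sum_i c i *: v i.

Definition finite_codim V (S : set V) : Prop :=
  exists (n : nat) (v : 'I_n -> V),
    forall x, exists2 y, S y & exists c : 'I_n -> K, x = y + \sum_i c i *: v i.

Definition fredholm V (T : set (V * V)) : Prop :=
  [/\ closed (ran T), finite_dim (ker T) & finite_codim (ran T)].

(* z is in the resolvent set when T - z is the inverse of a bounded operator
   defined on the whole space. *)
Definition resolvent_set V (T : set (V * V)) : set K :=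
  [set z | exists2 f : {linear V -> V}, continuous f &
    (T - z%:I)^-1%Op = [set p | p.2 = f p.1]].

Definition spectrum V (T : set (V * V)) : set K := ~` resolvent_set T.

Definition point_spectrum V (T : set (V * V)) : set K :=
  [set z | exists2 x, x != 0 & ker (T - z%:I)%Op x].

Definition continuous_spectrum V (T : set (V * V)) : set K :=
  [set z | [/\ ker (T - z%:I)%Op = [set 0],
               dense (ran (T - z%:I)%Op) & ran (T - z%:I)%Op <> setT]].

Definition essential_spectrum V (T : set (V * V)) : set K :=
  [set z | ~ fredholm (T - z%:I)%Op].

End Spectrum.

Definition separable (T : topologicalType) : Prop :=
  exists2 D : set T, countable D & dense D.

Section HilbertSpace.
Context {R : realType} {H : completeNormedModType R[i]}.
Variable dot : {dot H for @Num.conj R[i]}.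
Implicit Types T : set (H * H).

Definition adjoint T : set (H * H) :=
  [set p | forall x y, T (x, y) -> dot y p.1 = dot x p.2].

Definition self_adjoint T : Prop :=
  [/\ is_linear_op T, dense (dom T) & T = adjoint T].

Definition essentially_self_adjoint T : Prop := self_adjoint (closure T).

Definition orthogonal_projection (P : H -> H) : Prop :=
  [/\ linear P, (forall x, P (P x) = P x) &
      (forall x y, dot (P x) y = dot x (P y))].

(* E is the spectral measure of T, that is T = \int t dE(t): each mu x is the
   measure <E(.) x, x>, the domain of T consists of the x with
   \int t^2 d(mu x) < oo, and <T x, x> = \int t d(mu x) on it.  For the
   projections E(B), countable additivity of all the mu x is equivalent to
   strong countable additivity of E. *)
Definition is_spectral_measure (E : set R -> H -> H)
    (mu : H -> {measure set (measurableTypeR R) -> \bar R}) T : Prop :=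
  [/\ (forall B : set (measurableTypeR R), measurable B ->
         orthogonal_projection (E B)),
      (forall x, E setT x = x),
      (forall x (B : set (measurableTypeR R)), measurable B ->
         mu x B = (complex.Re (dot (E B x) x))%:E),
      dom T = [set x | (\int[mu x]_t (t ^+ 2)%:E < +oo)%E] &
      (forall x y, T (x, y) -> dot y x = (\int[mu x]_t t)%R%:C%C)].

(* kappa_-(T) < oo, where kappa_-(T) = dim ran chi_(-oo,0)(T). *)
Definition kappa_minus_finite T : Prop :=
  exists E mu, is_spectral_measure E mu T /\ finite_dim (range (E `]-oo, 0[%classic)).

End HilbertSpace.

Section BlockOperators.
Context {R : realType} {H : completeNormedModType R[i]}.
Variables (dot : {dot H for @Num.conj R[i]}) (A B C : set (H * H)).
Local Notation "T ^*" := (adjoint dot T) : op_scope.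

Definition op_S0 : set (H * H) := (B - C * (A^-1 * C^*))%Op.

Definition op_J : set ((H * H) * (H * H)) :=
  op_block 0%:I%Op 'i%C%:I%Op (- 'i%C)%:I%Op 0%:I%Op.

Definition op_A0 : set ((H * H) * (H * H)) := op_block A (C^*)%Op C B.

Definition op_L0 : set ((H * H) * (H * H)) := (op_J * op_A0)%Op.

Definition op_T (z : R[i]) : set (H * H) :=
  (B - (C + ('i%C * z)%R%:I) * (A^-1 * (C^* - ('i%C * z)%R%:I)))%Op.

(* Under the standing assumptions the natural domains of the operators above
   are the domains prescribed for them. *)
Lemma dom_inv_comp (P Q : set (H * H)) : resolvent_set A 0 ->
    dom A `<=` dom P -> dom (P * (A^-1 * Q))%Op = dom Q.
Proof.
case=> f _ fE AP; apply/seteqP; split=> x.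
  by case=> y [u [v Qxv _] _]; exists v.
case=> v Qxv.
have : (A - 0%:I)^-1%Op (v, f v) by rewrite fE.
case=> a [b [/= Aa]]; rewrite /op_opp /op_scal /= scale0r => /eqP; rewrite oppr_eq0 => /eqP b0.
rewrite b0 addr0 => va; rewrite -va in Aa.
have [|y Py] := AP (f v); first by exists v.
by exists y, (f v) => //; exists v.
Qed.

Lemma dom_add (P Q : set (H * H)) : dom (P + Q)%Op = dom P `&` dom Q.
Proof.
apply/seteqP; split=> x; first by case=> _ [u [v [/= Pu Qv _]]]; split; [exists u|exists v].
by case=> -[u Pu] [v Qv]; exists (u + v), u, v.
Qed.

Lemma dom_opp (P : set (H * H)) : dom (- P)%Op = dom P.
Proof.
apply/seteqP; split=> x [y]; first by exists (- y).
by move=> Pxy; exists (- y); rewrite /op_opp /= opprK.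
Qed.

Lemma dom_scal (a : R[i]) : dom (a%:I : set (H * H))%Op = setT.
Proof. by apply/seteqP; split=> x // _; exists (a *: x). Qed.

Lemma dom_S0 : resolvent_set A 0 -> dom A `<=` dom C ->
  dom op_S0 = dom (adjoint dot C) `&` dom B.
Proof.
by move=> rA AC; rewrite /op_S0 dom_add dom_opp dom_inv_comp// setIC.
Qed.

Lemma dom_T z : resolvent_set A 0 -> dom A `<=` dom C ->
  dom (op_T z) = dom (adjoint dot C) `&` dom B.
Proof.
move=> rA AC; rewrite /op_T dom_add dom_opp dom_inv_comp//.
  by rewrite dom_add dom_opp dom_scal setIT setIC.
by rewrite dom_add dom_scal setIT.
Qed.

Lemma dom_A0 : resolvent_set A 0 -> dom A `<=` dom C ->
  dom op_A0 = dom A `*` dom op_S0.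
Proof.
move=> rA AC; rewrite dom_S0//; apply/seteqP; split=> -[x y].
  case=> _ [a [b [c [d [/= Aa Cb Cc Bd _]]]]].
  by split; [exists a|split; [exists b|exists d]].
case=> /= -[a Aa] [[b Cb] [d Bd]]; have [|c Cc] := AC x; first by exists a.
by exists (a + b, c + d), a, b, c, d.
Qed.

Lemma dom_L0 : dom op_L0 = dom op_A0.
Proof.
apply/seteqP; split=> p; first by case=> _ [q /= Aq _]; exists q.
case=> q Aq; have [r Jr] : dom op_J q; last by exists r, q.
exists (0%:R *: q.1 + 'i%C *: q.2, (- 'i%C) *: q.1 + 0%:R *: q.2).
by exists (0%:R *: q.1), ('i%C *: q.2), ((- 'i%C) *: q.1), (0%:R *: q.2).
Qed.

End BlockOperators.

(* Main.v *)
Require Import Defs.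
From HB Require Import structures.
From mathcomp Require Import all_boot all_order all_algebra.
From mathcomp Require Import all_classical all_reals all_analysis.
From mathcomp Require Import complex.
From mathcomp Require Import ring.
Set Implicit Arguments.
Unset Strict Implicit.
Unset Printing Implicit Defensive.
Import Order.TTheory GRing.Theory Num.Theory.
Import numFieldNormedType.Exports.
Local Open Scope classical_set_scope.
Local Open Scope ring_scope.

(** With [F = C A^-1], which turns out to be bounded, and [G] the bounded
    everywhere defined closure of [A^-1 C^*], completing the square gives

      A0 (x, y) = (p, q)  iff  A (x + G y) = p  and  S0 y = q - F p,

    with no loss of domain, because [A (x + G y)] makes sense for [y] in
    [dom C^*] exactly when [x] is in [dom A].  So the graph of [A0] is the
    preimage of [A `*` S0] under a homeomorphism of the ambient space, and since
    closures commute with homeomorphisms and products, the closure of [A0] is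
    obtained by replacing [S0] with its closure ([closure_A0E]).  Multiplying by
    the unitary [J] is another homeomorphism ([closure_L0_A0]); this gives the
    factorization of [L] and the equality of the domains.  In the same way [T z]
    is [S0] plus a restriction of the bounded operator
    [i z F - i z G - z^2 A^-1], so its closure is the closure of [S0] plus that
    operator ([closure_TE]).

    Eliminating [x] from [(L - z) (x, y) = (p, q)] then leaves

      closure (T z) y = z A^-1 q - i (p + F q),
      x = i A^-1 q + (i z A^-1 - G) y,

    ([op_L_coupling]): [L - z] and the closure of [T z] differ only by a bounded
    surjection on the right-hand sides and the adjunction of a component [x]
    that is a bounded function of the other data.  Such a [coupled] pair has
    isomorphic kernels, and ranges that are preimages of each other, so
    injectivity, bounded invertibility, density, surjectivity and Fredholmness
    are shared; this gives all the spectral identities at once.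

    The analytic input is the boundedness of [F] and [G].  On the dense domain
    of [A^-1 C^*] one has [<F x, y> = <x, A^-1 C^* y>], and an everywhere defined
    operator with a densely defined formal adjoint is bounded
    ([Hellinger_Toeplitz], from the Baire category theorem).  The same bound then
    holds for [A^-1 C^*], which extends by density
    ([bounded_closure_graph]). *)

(** * Closures and continuity *)

Section Topology.

Lemma dense_closure (X : topologicalType) (D : set X) :
  dense D -> closure D = setT.
Proof.
move=> dD; apply/seteqP; split=> // x _ U /nbhs_interior Ux.
have [|y [Uy Dy]] := dD U° _ (open_interior U).
  by exists x; exact: (@nbhs_singleton _ x U°).
by exists y; split=> //; exact: interior_subset.
Qed.

Lemma closure_preimage_cancel (X Y : topologicalType) (f : X -> Y) (g : Y -> X)
    (S : set Y) : continuous f -> continuous g -> cancel f g -> cancel g f ->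
  closure (f @^-1` S) = f @^-1` closure S.
Proof.
move=> cf cg fK gK; apply/seteqP; split=> x.
  move=> Sx; have : closure (f @^-1` closure S) x.
    by apply: closureS Sx; apply: preimage_subset; exact: subset_closure.
  rewrite -((closure_id _).1 _)//.
  by apply: preimage_closed; [move=> y _; exact: cf|exact: closed_closure].
move=> Sfx U Ux.
have [y [Sy Uy]] : S `&` g @^-1` U !=set0.
  by apply: Sfx; apply: cg; rewrite fK.
by exists (g y); split=> //=; rewrite gK.
Qed.

Lemma closure_setX (X Y : topologicalType) (S : set X) (T : set Y) :
  closure (S `*` T) = closure S `*` closure T.
Proof.
apply/seteqP; split=> -[x y].
  move=> ST; split=> /= U Uz.
    have [|[a b] [[/= Sa Tb] Ua]] := ST (fst @^-1` U); first exact: cvg_fst.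
    by exists a.
  have [|[a b] [[/= Sa Tb] Ub]] := ST (snd @^-1` U); first exact: cvg_snd.
  by exists b.
case=> /= Sx Ty U [[V W] /= [Vx Wy] VWU].
have [a [Sa Va]] := Sx V Vx; have [b [Tb Wb]] := Ty W Wy.
by exists (a, b); split=> //; exact: VWU.
Qed.

Lemma continuous_pair (X Y Z : topologicalType) (f : X -> Y) (g : X -> Z) :
  continuous f -> continuous g -> continuous (fun x => (f x, g x)).
Proof. by move=> cf cg x; apply: cvg_pair; [exact: cf|exact: cg]. Qed.

Lemma continuous_fst (X Y : topologicalType) : continuous (@fst X Y).
Proof. by move=> x; exact: cvg_fst. Qed.

Lemma continuous_snd (X Y : topologicalType) : continuous (@snd X Y).
Proof. by move=> x; exact: cvg_snd. Qed.

End Topology.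

Section NormedContinuity.
Context {K : numFieldType} {X : topologicalType} {V : normedModType K}.
Implicit Types f g : X -> V.

Lemma continuous_add f g :
  continuous f -> continuous g -> continuous (fun x => f x + g x).
Proof. by move=> cf cg x; apply: cvgD; [exact: cf|exact: cg]. Qed.

Lemma continuous_opp f : continuous f -> continuous (fun x => - f x).
Proof. by move=> cf x; apply: cvgN; exact: cf. Qed.

Lemma continuous_scal (a : K) f :
  continuous f -> continuous (fun x => a *: f x).
Proof. by move=> cf x; apply: cvgZr; exact: cf. Qed.

Lemma continuous_after (W : normedModType K) (h : V -> W) f :
  continuous h -> continuous f -> continuous (fun x => h (f x)).
Proof. by move=> ch cf x; apply: continuous_comp; [exact: cf|exact: ch]. Qed.

End NormedContinuity.

Section BoundedLinear.
Context {K : numFieldType}.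
Implicit Types U V : normedModType K.

Lemma bounded_continuous U V (f : {linear U -> V}) (M : K) :
  0 <= M -> (forall x, `|f x| <= M * `|x|) -> continuous f.
Proof.
move=> M0 fM; apply: bounded_linear_continuous; apply/ex_bound.
exists M; apply/nbhs_norm0P; exists 1 => //= x /= /ltW x1.
by rewrite (le_trans (fM x))// ler_piMr.
Qed.

End BoundedLinear.

(** Norms are real elements, so over the complex numbers too the inequality can
    only fail by being strictly reversed, and a midpoint separates the two
    sides. *)
Lemma closed_le_norm (K : numFieldType) (X : topologicalType)
    (V W : normedModType K) (f : X -> V) (g : X -> W) :
  continuous f -> continuous g -> closed [set x | `|f x| <= `|g x|].
Proof.
move=> cf cg x; apply: contraPP => /=.
move=> /negP; rewrite -real_ltNge ?normr_real// => gf Sx.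
pose c := (`|g x| + `|f x|) / 2.
have [gc cf'] := (midf_lt gf).
have [] := Sx [set y | `|g y| < c /\ c < `|f y|].
  near=> y; split; near: y; first by apply: cvgr_norm_lt gc; exact: cg.
  by apply: cvgr_norm_gt cf'; exact: cf.
move=> y /= [fg [gy fy]].
have := lt_le_trans (lt_trans gy fy) fg; by rewrite ltxx.
Unshelve. all: by end_near. Qed.

(** * A Baire theorem over the complex numbers *)

Section ComplexNumbers.
Context {R : realType}.

Lemma ltr_invn_complex (e : R[i]) : 0 < e -> exists n : nat, n.+1%:R^-1 < e.
Proof.
case: e => a b; rewrite ltcE /= => /andP[/eqP-> a0].
exists (Num.bound a^-1).
have -> : ((Num.bound a^-1).+1%:R^-1 : R[i]) = ((Num.bound a^-1).+1%:R^-1)%:C%C.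
  by rewrite fmorphV /= rmorph_nat.
rewrite ltcE /= eqxx /= invf_plt ?posrE ?ltr0n//.
rewrite (lt_trans (archi_boundP _)) ?invr_ge0 ?ltW// ltr_nat//.
Qed.

Lemma complex_le_nat (r : R[i]) : 0 <= r -> exists n : nat, r <= n%:R.
Proof.
case: r => a b; rewrite lecE /= => /andP[/eqP-> a0].
exists (Num.bound a); rewrite -(rmorph_nat (real_complex R)) lecE /= eqxx /=.
by rewrite ltW// archi_boundP.
Qed.
End ComplexNumbers.

(** Baire category in the form used below.  If no [E n] had an interior point,
    one could choose nested neighbourhoods [U n] of points [x n], with the
    closure of [U (n+1)] inside [U n], and with [U (n+1)] of radius at most
    [1 / (n+1)] and disjoint from [E n]; the [x n] then converge to a point
    outside every [E n]. *)
Lemma Baire_cover {R : realType} (H : completeNormedModType R[i])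
    (E : nat -> set H) : (forall n, closed (E n)) -> (forall x, exists n, E n x) ->
  exists n (x : H), nbhs x (E n).
Proof.
move=> cE covE; apply: contrapT => noE.
(* The states are pairs of a point and a neighbourhood of it. *)
have step (n : nat) (p : H * set H) : exists q : H * set H, nbhs p.1 p.2 ->
    [/\ nbhs q.1 q.2, closure q.2 `<=` p.2, q.2 `<=` ball q.1 n.+1%:R^-1 &
        q.2 `<=` ~` E n].
  case: p => x U /=; have [Ux|nUx] := pselect (nbhs x U); last by exists (x, U).
  have [y [Uy nEy]] : exists y, U° y /\ ~ E n y.
    apply: contrapT => noy; apply: noE; exists n, x.
    apply: filterS (nbhs_interior Ux) => y Uy; apply: contrapT => nEy.
    by apply: noy; exists y.
  have [V Vy VU] := uniform_regular (Uy : nbhs y U).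
  exists (y, V `&` ball y n.+1%:R^-1 `&` ~` E n) => _ /=; split.
  - apply: filterI.
      by apply: filterI => //; apply: nbhsx_ballx; rewrite invr_gt0 ltr0n.
    by apply: open_nbhs_nbhs; split=> //; exact: closed_openC.
  - by apply: subset_trans VU; apply: closureS => z [[]].
  - by move=> z [[]].
  - by move=> z [].
pose next n p := sval (cid (step n p)).
have nextP n p := svalP (cid (step n p)).
pose fix s n : H * set H := if n is m.+1 then next m (s m) else (0, setT).
have sP n : nbhs (s n).1 (s n).2.
  elim: n => [|n IH]; first exact: filterT.
  by have [] := nextP n (s n) IH.
have sS n := nextP n (s n) (sP n).
have s_sub n m : (n <= m)%N -> (s m).2 `<=` (s n).2.
  move=> /subnK <-; elim: (m - n)%N => [//|k IH]; rewrite addSn.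
  apply: subset_trans IH; have [_ + _ _] := sS (k + n)%N.
  by apply: subset_trans; exact: subset_closure.
have s_cvg : cvg ((s n).1 @[n --> \oo]).
  apply: cauchy_cvg; apply/cauchyP => e /ltr_invn_complex[n ne].
  exists (s n.+1).1; exists n.+1 => // m /= nm.
  have [_ _ sub _] := sS n.
  apply: (le_ball (ltW ne)); apply: sub; apply: (s_sub n.+1 m nm).
  by apply: nbhs_singleton; exact: sP.
have [n Enx] := covE (lim ((s n).1 @[n --> \oo])).
have [_ _ _ nE] := sS n; apply: (nE (lim ((s n).1 @[n --> \oo]))) => //.
have [_ sub _ _] := sS n.+1; apply: sub.
apply: (closed_cvg (closure (s n.+2).2)) s_cvg.
  exact: closed_closure.
exists n.+2 => // m /= nm; apply: subset_closure; apply: (s_sub _ _ nm).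
by apply: nbhs_singleton; exact: sP.
Qed.

(** * Bounded operators and their closures *)

Lemma closure_linear_comb (K : numFieldType) (V : normedModType K) (S : set V) :
  (forall (a : K) p q, S p -> S q -> S (a *: p + q)) ->
  forall (a : K) p q, closure S p -> closure S q -> closure S (a *: p + q).
Proof.
move=> Sl a p q Sp Sq; have : closure (S `*` S) (p, q) by rewrite closure_setX.
have cS : closed ((fun u : V * V => a *: u.1 + u.2) @^-1` closure S).
  apply: preimage_closed; last exact: closed_closure.
  by move=> u _; apply: cvgD; [apply: cvgZr; exact: cvg_fst|exact: cvg_snd].
rewrite [X in _ -> X](_ : _ =
  ((fun u : V * V => a *: u.1 + u.2) @^-1` closure S) (p, q))//.
rewrite ((closure_id _).1 cS); apply: closureS => -[u v] [/= Su Sv].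
by apply: subset_closure; exact: Sl.
Qed.

(** Extension by density: at a point [x] the values of [T] along the trace on
    [dom T] of the neighbourhoods of [x] form a Cauchy filter, and its limit lies
    over [x] in the closure of the graph.  The bound survives in the closure,
    which therefore stays single-valued. *)
Lemma bounded_closure_graph (K : numFieldType) (U : normedModType K)
    (V : completeNormedModType K) (T : set (U * V)) (M : K) : 0 <= M ->
  T 0 -> (forall (a : K) p q, T p -> T q -> T (a *: p + q)) -> dense (dom T) ->
  (forall x y, T (x, y) -> `|y| <= M * `|x|) ->
  exists2 G : {linear U -> V}, continuous G & closure T = [set p | p.2 = G p.1].
Proof.
move=> M0 T0 Tl dT TM.
have Tsub p q : T p -> T q -> T (q - p).
  by move=> Tp Tq; rewrite addrC -scaleN1r; exact: Tl.
have cTM x y : closure T (x, y) -> `|y| <= M * `|x|.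
  have cM : closed [set p : U * V | `|p.2| <= `|M *: p.1|].
    apply: closed_le_norm; first exact: continuous_snd.
    exact/continuous_scal/continuous_fst.
  have TM' : T `<=` [set p : U * V | `|p.2| <= `|M *: p.1|].
    by move=> [u v] /TM /=; rewrite normrZ ger0_norm.
  by move/(closureS TM'); rewrite -((closure_id _).1 cM) /= normrZ ger0_norm.
have cTl := closure_linear_comb Tl.
have exG x : exists y, closure T (x, y).
  have exg u : exists v, dom T u -> T (u, v).
    by have [[v Tuv]|] := pselect (dom T u); [exists v|exists 0].
  pose g u := sval (cid (exg u)).
  have gP u : dom T u -> T (u, g u) := svalP (cid (exg u)).
  have FF : ProperFilter (within (dom T) (nbhs x)).
    apply: within_nbhs_proper; by rewrite dense_closure.
  have M1 : 0 < M + 1 by rewrite ltr_wpDl.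
  have : cvg (g u @[u --> within (dom T) (nbhs x)]).
    apply: cauchy_cvg; apply/cauchyP => e e0.
    have d0 : 0 < e / (2 * (M + 1)) by rewrite divr_gt0// mulr_gt0.
    have [u [Tu xu]] : dom T `&` ball x (e / (2 * (M + 1))) !=set0.
      have : closure (dom T) x by rewrite dense_closure.
      by apply; exact: nbhsx_ballx.
    exists (g u); rewrite /= /nbhs /= /within /=.
    near=> v => Tv /=.
    have := TM _ _ (Tsub _ _ (gP _ Tv) (gP _ Tu)).
    rewrite -ball_normE /ball_ /= => /le_lt_trans; apply.
    have uv : `|u - v| < e / (M + 1).
      have -> : u - v = (x - v) - (x - u) by rewrite opprB [RHS]addrC subrKA.
      rewrite (le_lt_trans (ler_normB _ _))//.
      have -> : e / (M + 1) = e / (2 * (M + 1)) + e / (2 * (M + 1)).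
        by rewrite [LHS]splitr invfM [2^-1 * _]mulrC mulrA.
      apply: ltrD; first by near: v; apply: cvgr_dist_lt => //; exact: cvg_id.
      by move: xu; rewrite -ball_normE.
    apply: (@le_lt_trans _ _ ((M + 1) * `|u - v|)).
      by rewrite ler_wpM2r// lerDl.
    by rewrite mulrC -ltr_pdivlMr.
  move=> cg; exists (lim (g u @[u --> within (dom T) (nbhs x)])).
  move=> W [[W1 W2] /= [W1x W2y] sW].
  have [z [Tz [/(_ Tz) W2z W1z]]] :
      dom T `&` [set u | (dom T u -> W2 (g u)) /\ W1 u] !=set0.
    have : closure (dom T) x by rewrite dense_closure.
    by apply; apply: filterI W1x; exact: (cg _ W2y).
  by exists (z, g z); split; [exact: gP|exact: sW].
have G_uniq x y y' : closure T (x, y) -> closure T (x, y') -> y = y'.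
  move=> Ty Ty'; apply/eqP; rewrite -subr_eq0 -normr_eq0 eq_le normr_ge0 andbT.
  have := cTl (-1) _ _ Ty' Ty; rewrite scaleN1r addrC /= => /cTM.
  by rewrite subrr normr0 mulr0.
pose G x := sval (cid (exG x)).
have GP x : closure T (x, G x) := svalP (cid (exG x)).
have linG : linear G.
  by move=> a x y; apply: (G_uniq _ _ _ (GP _)); exact: (cTl a _ _ (GP x) (GP y)).
pose G' : {linear U -> V} := HB.pack G (GRing.isLinear.Build _ _ _ _ _ linG).
exists G'; first by apply: (bounded_continuous M0) => x; exact: cTM.
apply/seteqP; split=> -[x y] /= Txy; last by rewrite Txy.
exact: G_uniq Txy (GP x).
Unshelve. all: by end_near. Qed.

(** * Hellinger-Toeplitz *)

Section Hilbert.
Context {R : realType} {H : completeNormedModType R[i]}.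
Variable dot : {dot H for @Num.conj R[i]}.
Hypothesis dotE : forall x : H, `|x| ^+ 2 = dot x x.

Lemma normr_dot_le (x y : H) : `|dot x y| <= `|x| * `|y|.
Proof.
have [->|y0] := eqVneq y 0; first by rewrite linear0r !normr0 mulr0.
have y2 : 0 < dot y y by rewrite neq0_dnorm_gt0.
rewrite -(@ler_pXn2r _ 2)// ?nnegrE ?mulr_ge0// exprMn !dotE.
pose a := dot x y / dot y y.
have := dnorm_ge0 dot (x - a *: y).
rewrite dnormB dnormZ linearZr_LR /=.
have ac : a^* = (dot x y)^* / dot y y.
  by rewrite /a rmorphM fmorphV /= (CrealP (gtr0_real y2)).
have e1 : a^* * dot x y = `|dot x y| ^+ 2 / dot y y.
  by rewrite ac normCK mulrAC [_^* * _]mulrC.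
have e2 : `|a| ^+ 2 * dot y y = `|dot x y| ^+ 2 / dot y y.
  rewrite /a normrM normfV (gtr0_norm y2) exprMn exprVn -mulrA.
  by congr (_ * _); rewrite expr2 invfM -mulrA mulVf ?mulr1// gt_eqF.
have e3 : (`|dot x y| ^+ 2 / dot y y)^* = `|dot x y| ^+ 2 / dot y y.
  by apply/CrealP; rewrite rpredM ?rpredX ?rpredV ?normr_real// gtr0_real.
rewrite e1 e2 e3.
by rewrite opprD addrA addrK subr_ge0 ler_pdivrMr.
Qed.

Lemma continuous_dotl (y : H) : continuous (fun x => dot x y : R[i]^o).
Proof.
have lin : linear (fun x => dot x y : R[i]^o).
  by move=> a u v; rewrite linearDl linearZl_LR.
pose f : {linear H -> R[i]^o} :=
  HB.pack (fun x => dot x y : R[i]^o) (GRing.isLinear.Build _ _ _ _ _ lin).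
apply: (@bounded_continuous _ _ _ f `|y|) => // x /=.
by rewrite mulrC; exact: normr_dot_le.
Qed.

Lemma continuous_dotr (x : H) : continuous (fun y => dot x y : R[i]^o).
Proof.
move=> y; apply/cvgrPdist_lt => e e0.
near=> z; rewrite -linearB /=; apply: le_lt_trans (normr_dot_le _ _) _.
have x1 : 0 < `|x| + 1 by rewrite ltr_wpDl.
apply: (@le_lt_trans _ _ ((`|x| + 1) * `|y - z|)); first by rewrite ler_wpM2r// lerDl.
rewrite mulrC -ltr_pdivlMr//; near: z.
by apply: cvgr_dist_lt; [exact: cvg_id|rewrite divr_gt0].
Unshelve. all: by end_near. Qed.

Lemma norm_le_dense (D : set H) (x : H) (c : R[i]) : dense D -> 0 <= c ->
  (forall y, D y -> `|dot x y| <= c * `|y|) -> `|x| <= c.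
Proof.
move=> dD c0 Dc.
have cc : closed [set y | `|dot x y : R[i]^o| <= `|c *: y|].
  apply: closed_le_norm; first exact: continuous_dotr.
  by apply: continuous_scal => y; exact: cvg_id.
have Dc' : D `<=` [set y | `|dot x y : R[i]^o| <= `|c *: y|].
  by move=> y /Dc /=; rewrite normrZ (ger0_norm c0).
have : closure D x by rewrite dense_closure.
move/(closureS Dc'); rewrite -((closure_id _).1 cc) /= -dotE.
rewrite normrX normr_id normrZ (ger0_norm c0).
have [->|x0] := eqVneq x 0; first by rewrite normr0.
by rewrite expr2 ler_pM2r// normr_gt0.
Qed.

(** The functionals [x |-> <x, v> / |y|], for [(y, v)] in [T] with [y] nonzero,
    are continuous and at each [x] bounded by [|F x|], because
    [<x, v> = <F x, y>].  Baire makes them bounded by some [n] on a ball, hence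
    uniformly bounded; testing [F x] against the dense set of the [y] recovers
    [|F x|]. *)
Lemma Hellinger_Toeplitz (F : {linear H -> H}) (T : set (H * H)) :
  dense (dom T) -> (forall x y v, T (y, v) -> dot (F x) y = dot x v) ->
  exists2 M, 0 <= M & forall x, `|F x| <= M * `|x|.
Proof.
move=> dT FT.
pose E n := [set x : H | forall y v, T (y, v) -> `|dot x v| <= n%:R * `|y|].
have EF n x : E n x -> `|F x| <= n%:R.
  move=> Ex; apply: (norm_le_dense dT) => // y [v Tyv].
  by rewrite (FT _ _ _ Tyv); exact: Ex.
have cE n : closed (E n).
  rewrite (_ : E n = \bigcap_(p in T) [set x | `|dot x p.2 : R[i]^o| <= `|n%:R *: p.1|]).
    apply: closed_bigI => p _; apply: closed_le_norm; first exact: continuous_dotl.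
    by move=> x; exact: cvg_cst.
  apply/seteqP; split=> x Ex.
    by move=> [y v] /= /Ex; rewrite normrZ normr_nat.
  by move=> y v /Ex; rewrite /= normrZ normr_nat.
have covE x : exists n, E n x.
  have [n Fn] := complex_le_nat (normr_ge0 (F x)).
  exists n => y v Tyv; rewrite -(FT _ _ _ Tyv).
  by rewrite (le_trans (normr_dot_le _ _))// ler_wpM2r.
have [n [x0 /nbhs_ballP[e /= e0 En]]] := Baire_cover cE covE.
exists (n%:R * 4 / e); first by rewrite divr_ge0 ?mulr_ge0// ltW.
move=> x; have [->|xn0] := eqVneq x 0; first by rewrite linear0 !normr0 mulr0.
have x_gt0 : 0 < `|x| by rewrite normr_gt0.
(* A multiple of [x] small enough for [t *: x + x0] to stay in the ball. *)
pose t := e / (2 * `|x|).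
have t0 : 0 < t by rewrite divr_gt0// mulr_gt0.
have b0 : `|F x0| <= n%:R by apply: EF; apply: En; exact: ballxx.
have b1 : `|F (t *: x + x0)| <= n%:R.
  apply: EF; apply: En; rewrite -ball_normE /ball_ /= opprD addrCA subrr addr0.
  rewrite normrN normrZ gtr0_norm// /t invfM mulrA mulfVK ?gt_eqF//.
  by rewrite gtr_pMr// invf_lt1// ltr1n.
have : `|t *: F x| <= n%:R + n%:R.
  have -> : t *: F x = F (t *: x + x0) - F x0 by rewrite linearP addrK.
  by rewrite (le_trans (ler_normB _ _))// lerD.
rewrite normrZ gtr0_norm// -ler_pdivlMl// => /le_trans; apply.
rewrite /t invf_div -mulr2n -mulr_natl le_eqVlt; apply/orP; left; apply/eqP.
by rewrite (_ : 4 = 2 * 2 :> R[i]) -?natrM//; field; rewrite gt_eqF.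
Qed.

End Hilbert.

(** * Coupled operators *)

(** [N u = q] amounts to the reduced equation [S y = P q] for the second
    component of [u], the first one being recovered from [q] and [y].  The right
    inverse [E] embeds the reduced equation into the full one; [X] vanishes on
    its range, so that the recovered component depends on [y] alone there. *)
Definition coupled (K : numFieldType) (V : normedModType K)
    (N : set ((V * V) * (V * V))) (S : set (V * V)) : Prop :=
  exists (P : {linear (V * V)%type -> V}) (E : {linear V -> (V * V)%type})
      (X : {linear (V * V)%type -> V}) (Y : {linear V -> V}),
    [/\ [/\ continuous P, continuous E, continuous X & continuous Y],
        cancel E P, (forall w, X (E w) = 0) &
        forall x y q, N ((x, y), q) <-> x = X q + Y y /\ S (y, P q)].

Section Coupling.
Context {K : numFieldType} {V : normedModType K}.
Variables (N : set ((V * V) * (V * V))) (S : set (V * V)).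
Hypothesis NS : coupled N S.

(** Everything but bounded invertibility depends on kernels and ranges only. *)
Lemma coupled_ker_ran : exists (P : {linear (V * V)%type -> V})
    (E : {linear V -> (V * V)%type}) (Y : {linear V -> V}),
  [/\ continuous P, continuous E, cancel E P, ran N = P @^-1` ran S &
      ker N = [set (Y y, y) | y in ker S]].
Proof.
have [P [E [X [Y [[cP cE cX cY] PE XE NSE]]]]] := NS.
exists P, E, Y; split=> //; apply/seteqP; split.
- by move=> q [[x y] /NSE[_ Sy]]; exists y.
- by move=> q [y Sy]; exists (X q + Y y, y); apply/NSE.
- move=> [x y] /NSE[->]; rewrite !linear0 add0r => Sy.
  by exists y.
- by move=> _ [y Sy <-]; apply/NSE; rewrite !linear0 add0r.
Qed.

Lemma coupled_bounded_inverse :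
  (exists2 f : {linear (V * V)%type -> (V * V)%type}, continuous f &
     (N^-1)%Op = [set p | p.2 = f p.1]) <->
  (exists2 f : {linear V -> V}, continuous f & (S^-1)%Op = [set p | p.2 = f p.1]).
Proof.
have [P [E [X [Y [[cP cE cX cY] PE XE NSE]]]]] := NS.
split=> -[f cf fE].
  have Nf p q : N (p, q) <-> p = f q.
    by rewrite -[N (p, q)]/((N^-1)%Op (q, p)) fE.
  pose h w := (f (E w)).2.
  have linh : linear h by move=> a u v; rewrite /h !linearP.
  exists (HB.pack h (GRing.isLinear.Build _ _ _ _ _ linh) : {linear V -> V}).
    apply: (@continuous_after _ _ _ _ snd (f \o E)); first exact: continuous_snd.
    exact: continuous_after.
  apply/seteqP; split=> -[w y] /=.
    move=> Syw; have /Nf : N ((Y y, y), E w).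
      by apply/NSE; rewrite XE add0r PE.
    by rewrite /h => <-.
  move=> ->; have := (Nf (f (E w)) (E w)).2 erefl; rewrite /op_inv /h /=.
  by case: (f (E w)) => x y' /NSE[_]; rewrite PE.
have Sf y w : S (y, w) <-> y = f w.
  by rewrite -[S (y, w)]/((S^-1)%Op (w, y)) fE.
pose h q := (X q + Y (f (P q)), f (P q)).
have linh : linear h.
  move=> a u v; rewrite /h !linearP /=; congr (_, _) => /=.
  by rewrite scalerDr addrACA.
exists (HB.pack h (GRing.isLinear.Build _ _ _ _ _ linh)
  : {linear (V * V)%type -> (V * V)%type}).
  apply: continuous_pair; last exact: continuous_after.
  by apply: (continuous_add cX); apply: (continuous_after cY); exact: continuous_after.
apply/seteqP; split=> -[q [x y]] /=.
  by move=> /NSE[-> /Sf ->].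
by move=> [-> ->]; apply/NSE; split=> //; apply/Sf.
Qed.

Lemma coupled_ker_ex :
  (exists2 x, x != 0 & ker N x) <-> (exists2 x, x != 0 & ker S x).
Proof.
have [P [E [Y [cP cE PE ranN kerN]]]] := coupled_ker_ran.
rewrite kerN; split=> [[p p0 [y Sy yp]]|[y y0 Sy]].
  exists y => //; apply: contra_neq p0 => y0.
  by rewrite -yp y0 linear0.
by exists (Y y, y); [apply: contra_neq y0 => /(congr1 snd)|exists y].
Qed.

Lemma coupled_ker0 : ker N = [set 0] <-> ker S = [set 0].
Proof.
have [P [E [Y [cP cE PE ranN kerN]]]] := coupled_ker_ran.
rewrite kerN; split=> [k0|->]; last first.
  by apply/seteqP; split=> [_ [_ -> <-]|_ ->]; [|exists 0]; rewrite ?linear0.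
apply/seteqP; split=> [y Sy|_ ->].
  have : [set (Y y, y) | y in ker S] (Y y, y) by exists y.
  by rewrite k0 => /(congr1 snd).
have : [set (Y y, y) | y in ker S] 0 by rewrite k0.
by case=> y Sy /(congr1 snd)/= <-.
Qed.

Lemma coupled_dense : dense (ran N) <-> dense (ran S).
Proof.
have [P [E [Y [cP cE PE ranN kerN]]]] := coupled_ker_ran.
rewrite ranN; split=> dS O.
  move=> [w Ow] oO; have [] := dS (P @^-1` O).
  - by exists (E w); rewrite /= PE.
  - by apply: open_comp => // q _; exact: cP.
  by move=> q [OPq SPq]; exists (P q).
(* [g] moves [q] along the range of [E] so that [P] takes the value [w]. *)
move=> [q Oq] oO; pose g w := q - E (P q) + E w.
have gP w : P (g w) = w by rewrite /g linearD linearB !PE subrr add0r.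
have [] := dS (g @^-1` O).
- by exists (P q); rewrite /= /g subrK.
- apply: open_comp => // w _; move: w.
  by apply: continuous_add => // w; exact: cvg_cst.
by move=> w [Ogw Sw]; exists (g w); split=> //=; rewrite gP.
Qed.

Lemma coupled_ranT : ran N = setT <-> ran S = setT.
Proof.
have [P [E [Y [cP cE PE ranN kerN]]]] := coupled_ker_ran.
rewrite ranN; split=> [NT|->]; last by rewrite preimage_setT.
by apply/seteqP; split=> // w _; rewrite -[w]PE -[ran S _]/((P @^-1` ran S) (E w)) NT.
Qed.

Lemma coupled_fredholm : fredholm N <-> fredholm S.
Proof.
have [P [E [Y [cP cE PE ranN kerN]]]] := coupled_ker_ran.
rewrite /fredholm ranN kerN; split=> -[cl [n [v kerv]] [m [w ranw]]]; split.
- rewrite (_ : ran S = E @^-1` (P @^-1` ran S)); last first.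
    by apply/seteqP; split=> y /=; rewrite PE.
  by apply: preimage_closed cl => y _; exact: cE.
- exists n, (fun i => (v i).2) => y Sy.
  have [|c yc] := kerv (Y y, y); first by exists y.
  by exists c; have := congr1 snd yc; rewrite raddf_sum.
- exists m, (fun i => P (w i)) => y.
  have [q Sq [c yc]] := ranw (E y); exists (P q) => //; exists c.
  rewrite -[y in LHS]PE yc linearD linear_sum; congr (_ + _).
  by apply: eq_bigr => i _; rewrite linearZ.
- by apply: preimage_closed cl => y _; exact: cP.
- exists n, (fun i => (Y (v i), v i)) => _ [y /kerv[c ->] <-].
  exists c; rewrite [RHS]surjective_pairing (raddf_sum fst) (raddf_sum snd) /=.
  by rewrite linear_sum; congr (_, _); apply: eq_bigr => i _; rewrite linearZ.
- exists m, (fun i => E (w i)) => q; have [y Sy [c yc]] := ranw (P q).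
  exists (q - \sum_i c i *: E (w i)); last by exists c; rewrite subrK.
  rewrite /= linearB yc linear_sum [X in _ - X](eq_bigr (fun i => c i *: w i)) ?addrK//.
  by move=> i _; rewrite linearZ PE.
Qed.

End Coupling.

(** * The block operators in decoupled coordinates *)

Lemma op_sub_scalE (K : numFieldType) (V : normedModType K) (T : set (V * V))
    (a : K) : (T - a%:I)%Op = [set p | T (p.1, p.2 + a *: p.1)].
Proof.
apply/seteqP; split=> -[x y] /=.
  by case=> u [v [/= Tu]]; rewrite /op_opp /op_scal /= => <- ->; rewrite addrK.
move=> Txy; exists (y + a *: x), (- (a *: x)).
by split; rewrite /op_opp /op_scal /= ?opprK ?addrK.
Qed.

Lemma op_sub_scal0 (K : numFieldType) (V : normedModType K) (T : set (V * V)) :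
  (T - 0%:I)%Op = T.
Proof.
rewrite op_sub_scalE.
by apply/seteqP; split=> -[x y] /=; rewrite scale0r addr0.
Qed.

Lemma mul_complexii (R : realType) : 'i%C * 'i%C = -1 :> R[i].
Proof.
apply/eqP; rewrite eq_complex /=.
by rewrite !(mul0r, mul1r, mulr0, sub0r, addr0, oppr0) !eqxx.
Qed.

Section BlockMatrix.
Context {R : realType} {H : completeNormedModType R[i]}.
Variables (dot : {dot H for @Num.conj R[i]}) (A B C : set (H * H)).
(* In the application [f] is [A^-1], [F] is [C A^-1] and [G] is the closure of
   [A^-1 C^*]. *)
Variables f F G : {linear H -> H}.
Hypotheses (cf : continuous f) (cF : continuous F) (cG : continuous G).
Hypothesis Af : forall x y, A (x, y) <-> x = f y.
Hypothesis CF : forall x y, C (f x, y) <-> y = F x.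
Hypothesis GC : forall y w, adjoint dot C (y, w) -> f w = G y.
Local Notation S0 := (op_S0 dot A B C).
Local Notation i := ('i%C : R[i]).

Lemma op_S0E y w : S0 (y, w) <->
  exists b c, [/\ B (y, b), adjoint dot C (y, c) & w = b - F c].
Proof.
split.
  case=> b [v [/= Byb [a [c Cyc Aac] Ca] ->]]; exists b, c; split=> //.
  move: Aac Ca; rewrite /op_inv /= => /Af -> /CF Fc.
  by rewrite -Fc opprK.
case=> b [c [Byb Cyc ->]]; exists b, (- F c); split=> //=.
exists (f c); first by exists c => //; exact/Af.
by rewrite /= opprK; exact/CF.
Qed.

(** Expanding [(C + i z) A^-1 (C^* - i z)] on [dom C^*], where [A^-1 C^*] is
    [G]; the square of [i z] accounts for the sign of the last term. *)
Lemma op_TE z y w : op_T dot A B C z (y, w) <->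
  S0 (y, w - ((i * z) *: F y - (i * z) *: G y - z ^+ 2 *: f y)).
Proof.
have iz2 : (i * z) * (i * z) = - z ^+ 2 by rewrite mulrACA mul_complexii mulN1r expr2.
have key b c : b - (F (c - (i * z) *: y) + (i * z) *: f (c - (i * z) *: y)) =
    b - F c + ((i * z) *: F y - (i * z) *: f c - z ^+ 2 *: f y).
  have lin (g : {linear H -> H}) a : g (c - a *: y) = g c - a *: g y.
    by rewrite linearB linearZ.
  by rewrite !lin scalerBr scalerA iz2 scaleNr opprK !opprD opprK !addrA.
split.
  case=> b [v [/= Byb [a [_ [c [d [/= Cyc + ->]]]]]]].
  rewrite /op_opp /op_scal /= => dE; rewrite /op_inv /= => /Af ->.
  case=> [e [g [/= /CF -> -> vE]]] ->.
  apply/op_S0E; exists b, c; split=> //.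
  rewrite -[v]opprK vE -[d]opprK dE key (GC Cyc) addrK //.
case/op_S0E => b [c [Byb Cyc /eqP]]; rewrite subr_eq -(GC Cyc) -key => /eqP wE.
exists b, (w - b); split=> //=; last by rewrite addrC subrK.
exists (f (c - (i * z) *: y)).
  exists (c - (i * z) *: y); last exact/Af.
  by exists c, (- ((i * z) *: y)); split=> //; rewrite /op_opp /op_scal /= opprK.
exists (F (c - (i * z) *: y)), ((i * z) *: f (c - (i * z) *: y)); split=> //=.
  exact/CF.
by rewrite wE addrAC subrr add0r opprK.
Qed.

(** Completing the square: the Frobenius-Schur factorization of [A0], as an
    equality of graphs. *)
Lemma op_A0E x y p q : op_A0 dot A B C ((x, y), (p, q)) <->
  A (x + G y, p) /\ S0 (y, q - F p).
Proof.
split.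
  case=> a [b [c [d [/= /Af -> Cyb /CF -> Byd [-> ->]]]]].
  split; first by apply/Af; rewrite linearD (GC Cyb).
  apply/op_S0E; exists d, b; split=> //.
  by rewrite linearD opprD addrACA subrr add0r.
case=> /Af xE /op_S0E[d [b [Byd Cyb qE]]].
have {}xE : x = f (p - b) by rewrite linearB -xE (GC Cyb) addrK.
exists (p - b), b, (F (p - b)), d; split=> //=; first exact/Af.
  by rewrite xE; exact/CF.
congr (_, _); first by rewrite subrK.
by rewrite linearB -addrA [- _ + _]addrC -qE addrC subrK.
Qed.

Lemma op_L0E x y p q : op_L0 dot A B C ((x, y), (p, q)) <->
  op_A0 dot A B C ((x, y), (i *: q, - (i *: p))).
Proof.
split.
  case=> -[a b] Ap [a' [b' [c' [d' []]]]].
  rewrite /op_scal /= => -> -> -> -> [-> ->].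
  rewrite !scale0r add0r addr0 !scalerA mulrN mul_complexii !opprK.
  rewrite scaleN1r opprK.
  by rewrite scale1r.
move=> Ap; exists (i *: q, - (i *: p)) => //.
exists 0, (- (i *: (i *: p))), (- (i *: (i *: q))), 0; split=> /=.
- by rewrite /op_scal /= scale0r.
- by rewrite /op_scal /= scalerN.
- by rewrite /op_scal /= scaleNr.
- by rewrite /op_scal /= scale0r.
by rewrite add0r addr0 !scalerA mul_complexii !scaleN1r !opprK.
Qed.

Lemma closure_A : closure A = A.
Proof.
have -> : A = [set p | `|p.1 - f p.2| <= `|0 : H|].
  apply/seteqP; split=> -[x y] /=.
    by move=> /Af ->; rewrite subrr.
  by rewrite normr0 normr_le0 subr_eq0 => /eqP xE; apply/Af.
symmetry; apply/closure_id/closed_le_norm; last by move=> x; exact: cvg_cst.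
apply: continuous_add; first exact: continuous_fst.
by apply: continuous_opp; apply: continuous_after cf _; exact: continuous_snd.
Qed.

(** The shear [(y, w) |-> (y, w - K y)] is a homeomorphism because [K] is
    bounded. *)
Lemma closure_TE z : closure (op_T dot A B C z) = [set p |
  closure S0 (p.1, p.2 - ((i * z) *: F p.1 - (i * z) *: G p.1 - z ^+ 2 *: f p.1))].
Proof.
pose K (y : H) := (i * z) *: F y - (i * z) *: G y - z ^+ 2 *: f y.
have cK : continuous (fun p : H * H => K p.1).
  apply: continuous_add; first apply: continuous_add; last 2 first.
  - apply: continuous_opp; apply: continuous_scal.
    by apply: continuous_after cG _; exact: continuous_fst.
  - apply: continuous_opp; apply: continuous_scal.
    by apply: continuous_after cf _; exact: continuous_fst.
  - apply: continuous_scal.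
    by apply: continuous_after cF _; exact: continuous_fst.
rewrite -[RHS]/((fun p => (p.1, p.2 - K p.1)) @^-1` closure S0).
rewrite -(@closure_preimage_cancel _ _ _ (fun p => (p.1, p.2 + K p.1))).
- congr closure; apply/seteqP; split=> -[y w] /=; first by move/op_TE.
  by move=> Sy; apply/op_TE.
- apply: continuous_pair; first exact: continuous_fst.
  by apply: continuous_add; [exact: continuous_snd|exact: continuous_opp].
- apply: continuous_pair; first exact: continuous_fst.
  by apply: continuous_add; [exact: continuous_snd|].
- by move=> -[y w] /=; rewrite subrK.
- by move=> -[y w] /=; rewrite addrK.
Qed.

(** The coordinate change of [op_A0E] is a homeomorphism because [F] and [G] are
    bounded, and it carries [A0] to a product whose first factor is closed. *)
Lemma closure_A0E : closure (op_A0 dot A B C) = [set u |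
  A (u.1.1 + G u.1.2, u.2.1) /\ closure S0 (u.1.2, u.2.2 - F u.2.1)].
Proof.
pose phi (u : (H * H) * (H * H)) := ((u.1.1 + G u.1.2, u.2.1), (u.1.2, u.2.2 - F u.2.1)).
pose psi (u : (H * H) * (H * H)) := ((u.1.1 - G u.2.1, u.2.1), (u.1.2, u.2.2 + F u.1.2)).
have c11 : continuous (fun u : (H * H) * (H * H) => u.1.1).
  by move=> u; apply: (cvg_comp _ _ (@cvg_fst _ _ _ _ _)); exact: cvg_fst.
have c12 : continuous (fun u : (H * H) * (H * H) => u.1.2).
  by move=> u; apply: (cvg_comp _ _ (@cvg_fst _ _ _ _ _)); exact: cvg_snd.
have c21 : continuous (fun u : (H * H) * (H * H) => u.2.1).
  by move=> u; apply: (cvg_comp _ _ (@cvg_snd _ _ _ _ _)); exact: cvg_fst.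
have c22 : continuous (fun u : (H * H) * (H * H) => u.2.2).
  by move=> u; apply: (cvg_comp _ _ (@cvg_snd _ _ _ _ _)); exact: cvg_snd.
rewrite -[RHS]/(phi @^-1` (A `*` closure S0)) -{2}closure_A -closure_setX.
rewrite -(@closure_preimage_cancel _ _ phi psi).
- congr closure; apply/seteqP; split=> -[[x y] [p q]] /=; first by move/op_A0E.
  by move=> Sy; apply/op_A0E.
- apply: continuous_pair; apply: continuous_pair => //; apply: continuous_add => //.
    exact: continuous_after.
  by apply: continuous_opp; exact: continuous_after.
- apply: continuous_pair; apply: continuous_pair => //; apply: continuous_add => //.
    by apply: continuous_opp; exact: continuous_after.
  exact: continuous_after.
- by move=> -[[x y] [p q]]; rewrite /phi /psi /= addrK subrK.
- by move=> -[[x y] [p q]]; rewrite /phi /psi /= addrK subrK.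
Qed.

Lemma closure_L0_A0 : closure (op_L0 dot A B C) =
  [set u | closure (op_A0 dot A B C) (u.1, (i *: u.2.2, - (i *: u.2.1)))].
Proof.
(* Applying [J], which is an involution. *)
pose phi (u : (H * H) * (H * H)) := (u.1, (i *: u.2.2, - (i *: u.2.1))).
have cphi : continuous phi.
  apply: continuous_pair; first exact: continuous_fst.
  apply: continuous_pair; last apply: continuous_opp; apply: continuous_scal.
    by move=> u; apply: (cvg_comp _ _ (@cvg_snd _ _ _ _ _)); exact: cvg_snd.
  by move=> u; apply: (cvg_comp _ _ (@cvg_snd _ _ _ _ _)); exact: cvg_fst.
have phiK : cancel phi phi.
  move=> -[u [p q]]; rewrite /phi /= scalerN !scalerA mul_complexii !scaleN1r !opprK.
  by [].
rewrite -[RHS]/(phi @^-1` closure (op_A0 dot A B C)).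
rewrite -(closure_preimage_cancel _ cphi cphi phiK phiK).
by congr closure; apply/seteqP; split=> -[[x y] [p q]] /=; move/op_L0E.
Qed.

End BlockMatrix.

(** * The closure of [L0] and its spectra *)

Section SpectralReduction.
Context {R : realType} {H : completeNormedModType R[i]}.
Variables (dot : {dot H for @Num.conj R[i]}) (A B C : set (H * H)).
(* As before, [f] is [A^-1], [F] is [C A^-1] and [G] is the closure of
   [A^-1 C^*]. *)
Variables f F G : {linear H -> H}.
Hypotheses (cf : continuous f) (cF : continuous F) (cG : continuous G).
Hypothesis Af : forall x y, A (x, y) <-> x = f y.
Hypothesis CF : forall x y, C (f x, y) <-> y = F x.
Hypothesis GC : forall y w, adjoint dot C (y, w) -> f w = G y.
Local Notation S0 := (op_S0 dot A B C).
Local Notation i := ('i%C : R[i]).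
Local Notation L := (closure (op_L0 dot A B C)).
Local Notation T z := (closure (op_T dot A B C z)).
Hypothesis A_lin : is_linear_op A.
Hypothesis S0_lin : is_linear_op (closure S0).

Lemma closable_op_T z : closable (op_T dot A B C z).
Proof.
rewrite /closable (closure_TE B cf cF cG Af CF GC).
have [S00 S0l S0u] := S0_lin.
pose K : {linear H -> H} := (i * z) \*: F \- (i * z) \*: G \- z ^+ 2 \*: f.
split.
- by rewrite -[_ 0]/(closure S0 (0, 0 - K 0)) linear0 subr0.
- move=> a p q Sp Sq.
  rewrite -[_ (_ + _)]/(closure S0 (a *: p.1 + q.1, a *: p.2 + q.2 - K (a *: p.1 + q.1))).
  rewrite (_ : (_, _) = a *: (p.1, p.2 - K p.1) + (q.1, q.2 - K q.1)); first exact: S0l.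
  have -> : K (a *: p.1 + q.1) = a *: K p.1 + K q.1 by exact: linearP.
  move: (K p.1) (K q.1) => k1 k2.
  by rewrite [RHS]surjective_pairing /= scalerBr opprD addrACA.
- by move=> x y y' /= Sy Sy'; apply: (addIr (- K x)); exact: S0u Sy Sy'.
Qed.

Lemma closable_op_A0 : closable (op_A0 dot A B C).
Proof.
rewrite /closable (closure_A0E B cf cF cG Af CF GC).
have [S00 S0l S0u] := S0_lin; have [A0 Al Au] := A_lin.
split.
- rewrite -[_ 0]/(A (0 + G 0, 0) /\ closure S0 (0, 0 - F 0)).
  by rewrite !linear0 !addr0.
- move=> a [[x y] [p q]] [[x' y'] [p' q']] /= [Ap Sq] [Ap' Sq']; split.
    have := Al a _ _ Ap Ap'; congr (A (_, _)) => /=.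
    by rewrite linearP scalerDr addrACA.
  have := S0l a _ _ Sq Sq'; congr (closure S0 (_, _)) => /=.
  by rewrite linearP scalerBr opprD addrACA.
- move=> [x y] [p q] [p' q'] /= [Ap Sq] [Ap' Sq'].
  have pp' := Au _ _ _ Ap Ap'; rewrite -pp' in Sq' *.
  by congr (_, _); apply: (addIr (- F p)); exact: S0u Sq Sq'.
Qed.

Lemma closable_op_L0 : closable (op_L0 dot A B C).
Proof.
rewrite /closable closure_L0_A0.
have [A00 A0l A0u] := closable_op_A0.
split.
- rewrite -[_ 0]/(closure (op_A0 dot A B C) (0, (i *: 0, - (i *: 0)))).
  by rewrite scaler0 oppr0.
- move=> a [u [p q]] [v [p' q']] /= Au Av.
  have := A0l a _ _ Au Av; congr (closure _ (_, (_, _))) => /=.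
    by rewrite scalerDr !scalerA [a * _]mulrC.
  by rewrite scalerN -opprD scalerDr !scalerA [a * _]mulrC.
- move=> u [p q] [p' q'] /= Au Av.
  have [/(congr1 ( *:%R (- i))) + /(congr1 ( *:%R i))] := A0u _ _ _ Au Av.
  rewrite !scalerN !scaleNr !scalerA mul_complexii !scaleN1r !opprK.
  by move=> -> ->.
Qed.

Lemma closure_L0E x y p q : L ((x, y), (p, q)) <->
  A (x + G y, i *: q) /\ closure S0 (y, - (i *: (p + F q))).
Proof.
rewrite closure_L0_A0 (closure_A0E B cf cF cG Af CF GC) /=.
have -> : F (i *: q) = i *: F q by rewrite linearZ.
by rewrite scalerDr opprD.
Qed.

Lemma closure_L0_factorization :
  closure (A^-1 * adjoint dot C)%Op = [set p | p.2 = G p.1] ->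
  L = (op_block 1%:I (- (C * A^-1)) 0%:I 1%:I *
       (op_block 0%:I ('i%C%:I * T 0) ((- 'i%C)%R%:I * A) 0%:I *
        op_block 1%:I (closure (A^-1 * adjoint dot C)) 0%:I 1%:I))%Op.
Proof.
move=> GE.
have T0 : T 0 = closure S0.
  rewrite (closure_TE B cf cF cG Af CF GC); apply/seteqP; split=> -[y w] /=;
  by rewrite mulr0 expr0n /= !scale0r !subr0.
rewrite T0 GE; apply/seteqP; split=> -[[x y] [p q]].
  move=> /closure_L0E[Aq Sp].
  exists (p + F q, q) => /=.
    exists (x + G y, y).
      by exists x, (G y), 0, y; rewrite /op_scal /= !scale1r scale0r add0r.
    exists 0, (p + F q), q, 0; rewrite /= /op_scal /= !scale0r add0r addr0; split=> //.
      exists (- (i *: (p + F q))) => //.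
      by rewrite /= scalerN scalerA mul_complexii scaleN1r opprK.
    exists (i *: q) => //.
    by rewrite /= scaleNr scalerA mul_complexii scaleN1r opprK.
  exists (p + F q), (- F q), 0, q.
  rewrite /= /op_scal /= /op_opp /= !scale1r scale0r add0r addrK.
  split=> //; exists (f q); [exact/Af|by rewrite opprK; exact/CF].
case=> -[p1 q1] [[x1 y1]] [a [b [c [d []]]]]; rewrite /op_scal /= => -> -> -> ->.
rewrite !scale1r scale0r add0r => -[-> ->] {x1 y1 a b c d}.
case=> [a [b [c [d []]]]]; rewrite /op_scal /= => -> [s Ss +] [t At +] ->.
rewrite /= => bE cE; rewrite !scale0r add0r addr0 => -[-> ->] {p1 q1 a d}.
case=> [a [e [g [d []]]]]; rewrite /op_scal /op_opp /= => -> [v Av Cv] -> ->.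
rewrite !scale1r scale0r add0r => -[-> ->].
have {Av Cv} eE : e = - F c.
  move: Av Cv; rewrite /op_inv /= => /Af -> /CF <-; by rewrite opprK.
apply/closure_L0E; rewrite eE subrK bE cE /= !scalerA mulrN mul_complexii.
by rewrite opprK scale1r scaleN1r opprK.
Qed.

(** Elimination of the first component: [A (x + G y) = i (q + z y)] determines
    [x], and substituting it into the second equation produces exactly the
    bounded terms by which the closure of [T z] differs from that of [S0]. *)
Lemma op_L_coupling z x y u :
  (L - z%:I)%Op ((x, y), u) <->
  x = i *: f u.2 + ((i * z) *: f y - G y) /\
  T z (y, z *: f u.2 - i *: (u.1 + F u.2)).
Proof.
case: u => p q; rewrite op_sub_scalE (closure_TE B cf cF cG Af CF GC) /=.
have xE : (x + G y = f (i *: (q + z *: y))) <-> x = i *: f q + ((i * z) *: f y - G y).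
  rewrite linearZ linearD linearZ /= scalerDr scalerA addrA; split=> [<-|->].
    by rewrite addrK.
  by rewrite subrK.
have sE : x = i *: f q + ((i * z) *: f y - G y) ->
   - (i *: (p + z *: x + F (q + z *: y))) =
   z *: f q - i *: (p + F q) - ((i * z) *: F y - (i * z) *: G y - z ^+ 2 *: f y).
  move=> xE'.
  have zx : (i * z) *: x = - (z *: f q) - z ^+ 2 *: f y - (i * z) *: G y.
    have izi : i * z * i = - z by rewrite mulrAC mul_complexii mulN1r.
    have iziz : i * z * (i * z) = - z ^+ 2 by rewrite mulrA izi mulNr.
    by rewrite xE' scalerDr scalerBr !scalerA izi iziz !scaleNr addrA.
  have -> : F (q + z *: y) = F q + z *: F y by rewrite linearD linearZ.
  rewrite !scalerDr !scalerA zx !opprD !opprK !addrA.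
  by rewrite [LHS](ACl (2*1*5*6*4*3)).
rewrite -[L _]/(L ((x, y), (p + z *: x, q + z *: y))).
split=> [/closure_L0E[/Af/xE xE1 Sy]|[xE1 Sy]].
  by rewrite -sE.
by apply/closure_L0E; split; [apply/Af/xE|rewrite sE].
Qed.

(** The right inverse is [w |-> (i w, 0)], on which [P] is [w |-> - i (i w)]. *)
Lemma coupled_L_T z : coupled (L - z%:I)%Op (T z).
Proof.
have linE : linear (fun w : H => (i *: w, 0 : H)).
  move=> a u v; apply/eqP; rewrite xpair_eqE /= scaler0 addr0 eqxx andbT.
  by rewrite scalerDr !scalerA mulrC.
exists (z \*: (f \o snd) \- i \*: (fst \+ (F \o snd)) : {linear (H * H)%type -> H}).
exists (HB.pack (fun w : H => (i *: w, 0 : H))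
  (GRing.isLinear.Build _ _ _ _ _ linE) : {linear H -> (H * H)%type}).
exists (i \*: (f \o snd) : {linear (H * H)%type -> H}).
exists ((i * z) \*: f \- G : {linear H -> H}).
have cz (h : {linear H -> H}) : continuous h -> continuous (fun u : H * H => h u.2).
  by move=> ch; apply: continuous_after ch _; exact: continuous_snd.
split=> /=.
- split.
  + apply: continuous_add; first by apply: continuous_scal; exact: cz.
    apply: continuous_opp; apply: continuous_scal; apply: continuous_add; last exact: cz.
    exact: continuous_fst.
  + apply: continuous_pair; last by move=> w; exact: cvg_cst.
    by apply: continuous_scal => w; exact: cvg_id.
  + by apply: continuous_scal; exact: cz.
  + apply: continuous_add; first exact: continuous_scal.
    exact: continuous_opp.
- move=> w /=; rewrite !linear0 addr0 add0r scalerA mul_complexii scaleN1r.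
  by rewrite opprK.
- by move=> w /=; rewrite !linear0.
- by move=> x y q; exact: op_L_coupling.
Qed.

End SpectralReduction.

Lemma adjoint_linear_comb (R : realType) (H : completeNormedModType R[i])
    (dot : {dot H for @Num.conj R[i]}) (S : set (H * H)) (a : R[i]) p q :
  adjoint dot S p -> adjoint dot S q -> adjoint dot S (a *: p + q).
Proof.
case: p q => [p1 p2] [q1 q2] Sp Sq x y Sxy /=.
have := Sp _ _ Sxy; have := Sq _ _ Sxy => /= Sq1 Sp1.
by rewrite !linearDr !linearZr_LR /= Sp1 Sq1.
Qed.

Theorem theorem3p1 (R : realType) (H : completeNormedModType R[i])
    (dot : {dot H for @Num.conj R[i]}) (A B C : set (H * H))
  (dotE : forall x : H, `|x| ^+ 2 = dot x x)
  (H_sep : separable H)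
  (A_sa : self_adjoint dot A)
  (A_inv : resolvent_set A 0)
  (A_neg : kappa_minus_finite dot A)
  (C_lin : is_linear_op C)
  (C_closed : closed C)
  (A_sub_C : dom A `<=` dom C)
  (A_sub_Cadj : dom A `<=` dom (adjoint dot C))
  (B_sa : self_adjoint dot B)
  (S0_dense : dense (dom (adjoint dot C) `&` dom B))
  (S0_esa : essentially_self_adjoint dot (op_S0 dot A B C))
  (S0_neg : kappa_minus_finite dot (closure (op_S0 dot A B C))) :
  let L := closure (op_L0 dot A B C) in
  let T z := closure (op_T dot A B C z) in
  [/\ [/\ closable (op_A0 dot A B C), closable (op_L0 dot A B C),
          (forall z, closable (op_T dot A B C z)) &
          closable (A^-1 * adjoint dot C)%Op],
      L = (op_block 1%:I (- (C * A^-1)) 0%:I 1%:I *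
           (op_block 0%:I ('i%C%:I * T 0) ((- 'i%C)%R%:I * A) 0%:I *
            op_block 1%:I (closure (A^-1 * adjoint dot C)) 0%:I 1%:I))%Op,
      dom L = dom (closure (op_A0 dot A B C)),
      spectrum L = [set z | spectrum (T z) 0] &
      [/\ point_spectrum L = [set z | point_spectrum (T z) 0],
          continuous_spectrum L = [set z | continuous_spectrum (T z) 0] &
          essential_spectrum L = [set z | essential_spectrum (T z) 0]]].
Proof.
move=> L T.
have [f cf fE] := A_inv; rewrite op_sub_scal0 in fE.
have Af x y : A (x, y) <-> x = f y.
  by rewrite -[A (x, y)]/((A^-1)%Op (y, x)) fE.
have [A_lin _ A_adj] := A_sa.
have [C0 Cl Cu] := C_lin.
(* [C A^-1] is everywhere defined, as [A^-1] maps into [dom A]. *)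
have exF y : exists w, C (f y, w).
  by apply: A_sub_C; exists y; exact/Af.
pose F0 y := sval (cid (exF y)).
have F0P y : C (f y, F0 y) := svalP (cid (exF y)).
have F0_lin : linear F0.
  move=> a x y; apply: Cu (F0P _) _; rewrite linearP.
  exact: Cl (F0P x) (F0P y).
pose F : {linear H -> H} := HB.pack F0 (GRing.isLinear.Build _ _ _ _ _ F0_lin).
have CF x y : C (f x, y) <-> y = F x.
  by split=> [Cy|->]; [exact: Cu Cy (F0P x)|exact: F0P].
pose Q := (A^-1 * adjoint dot C)%Op.
have FQ x y v : Q (y, v) -> dot (F x) y = dot x v.
  case=> w Cyw; rewrite /op_inv /= => Avw.
  have : adjoint dot A (v, w) by rewrite -A_adj.
  move=> /(_ (f x) x) /= ->; last exact/Af.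
  by apply: Cyw; exact: F0P.
have Q_dense : dense (dom Q).
  move=> O O0 oO; have [y [Oy [[w Cyw] _]]] := S0_dense O O0 oO.
  exists y; split=> //; exists (f w); exists w => //; exact/Af.
have [M M0 FM] := Hellinger_Toeplitz dotE Q_dense FQ.
have cF : continuous F by exact: bounded_continuous M0 FM.
(* [F] and [Q] are formal adjoints of each other, so they share the bound. *)
have QM y v : Q (y, v) -> `|v| <= M * `|y|.
  move=> Qyv; have Fv := FQ v _ _ Qyv.
  have [->|v0] := eqVneq v 0; first by rewrite normr0 mulr_ge0.
  rewrite -(@ler_pM2l _ `|v|) ?normr_gt0// -expr2.
  have -> : `|v| ^+ 2 = `|dot (F v) y| by rewrite Fv -dotE normrX normr_id.
  rewrite (le_trans (normr_dot_le dotE _ _))// mulrA [`|v| * M]mulrC.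
  by rewrite ler_wpM2r.
have [A0 Al _] := A_lin.
have [||G cG GE] := bounded_closure_graph M0 _ _ Q_dense QM.
- exists 0 => //=; by move=> x y _; rewrite !linear0r.
- move=> a [y v] [y' v'] [w Cw Aw] [w' Cw' Aw']; exists (a *: w + w').
    exact: (adjoint_linear_comb a Cw Cw').
  exact: (Al a _ _ Aw Aw').
have GC y w : adjoint dot C (y, w) -> f w = G y.
  move=> Cyw; have : closure Q (y, f w).
    by apply: subset_closure; exists w => //; exact/Af.
  by rewrite GE.
have [S0_lin _ _] := S0_esa.
have LT z := coupled_L_T B cf cF cG Af CF GC z.
have res z : resolvent_set L z <-> resolvent_set (T z) 0.
  rewrite /resolvent_set /= op_sub_scal0; exact: coupled_bounded_inverse (LT z).
split.
- split.
  + exact: closable_op_A0 cf cF cG Af CF GC A_lin S0_lin.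
  + exact: closable_op_L0 cf cF cG Af CF GC A_lin S0_lin.
  + by move=> z; exact: (closable_op_T cf cF cG Af CF GC S0_lin).
  + rewrite /closable GE; split=> /=.
    * exact: (esym (linear0 G)).
    * by move=> a [x y] [x' y'] /= -> ->; rewrite linearP.
    * by move=> x y y' /= -> ->.
- exact: closure_L0_factorization cf cF cG Af CF GC GE.
- rewrite /L closure_L0_A0; apply/seteqP; split=> -[x y] [[p q]] /=.
    by move=> Aq; exists ('i%C *: q, - ('i%C *: p)).
  move=> Ap; exists ('i%C *: q, - ('i%C *: p)) => /=.
  by rewrite scalerN !scalerA mul_complexii !scaleN1r !opprK.
- by apply/seteqP; split=> z; apply: contra_not => /res.
split.
- apply/seteqP; split=> z; rewrite /point_spectrum /= op_sub_scal0;
  by move/(coupled_ker_ex (LT z)).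
- apply/seteqP; split=> z; rewrite /continuous_spectrum /= op_sub_scal0 => -[k0 d r].
    split; [exact/(coupled_ker0 (LT z))|exact/(coupled_dense (LT z))|].
    by move/(coupled_ranT (LT z)).
  split; [exact/(coupled_ker0 (LT z))|exact/(coupled_dense (LT z))|].
  by move/(coupled_ranT (LT z)).
- apply/seteqP; split=> z; rewrite /essential_spectrum /= op_sub_scal0;
  by move=> nf /(coupled_fredholm (LT z)).
Qed.
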